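(* Let $G$ be a connected graph with $n$ vertices and minimum degree at least $k$. Then $$\gamma_c(G)\le\frac{n\big(\ln(k+1)+\ln\lceil\ln(k+1)\rceil+4\big)}{k+1}.$$
   Context: $\gamma_c(G)$ is the minimum size of a connected dominating set of $G$, i.e. a set $X$ of vertices such that every vertex outside $X$ has a neighbor in $X$ and the induced subgraph of $G$ on $X$ is connected. *)

(* Defs.v *)
From HB Require Import structures.
From mathcomp Require Import all_boot all_order all_algebra.
From mathcomp Require Import all_reals all_analysis.

Set Implicit Arguments.
Unset Strict Implicit.
Unset Printing Implicit Defensive.

Record sgraph := SGraph {
  vertex :> finType;
  edge : rel vertex;
  edge_sym : symmetric edge;
  edge_irrefl : irreflexive edge }.

Definition degree (G : sgraph) (v : G) : nat := #|[set w | edge v w]|.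

(* Degrees are smaller than #|G|, so the default value #|G| is never attained
   when G is nonempty. *)
Definition min_degree (G : sgraph) : nat := \big[minn/#|G|]_(v : G) degree v.

(* The graph without vertices is not connected. *)
Definition connected_graph (G : sgraph) : bool :=
  (0 < #|G|) && [forall x : G, forall y : G, connect (@edge G) x y].

Section Induced.
Variables (G : sgraph) (X : {set G}).

Definition induced_edge : rel {x : G | x \in X} :=
  fun x y => edge (val x) (val y).

Lemma induced_edge_sym : symmetric induced_edge.
Proof. by move=> x y; apply: edge_sym. Qed.

Lemma induced_edge_irrefl : irreflexive induced_edge.
Proof. by move=> x; apply: edge_irrefl. Qed.

Definition induced : sgraph := SGraph induced_edge_sym induced_edge_irrefl.

End Induced.

Definition dominating (G : sgraph) (X : {set G}) : bool :=
  [forall v : G, (v \notin X) ==> [exists w : G, (w \in X) && edge v w]].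

Definition connected_dominating (G : sgraph) (X : {set G}) : bool :=
  dominating X && connected_graph (induced X).

(* The seed [set: G] of the minimisation is itself a connected dominating set
   when G is connected; gamma_c is meaningful only for such G. *)
Definition gamma_c (G : sgraph) : nat :=
  #|[arg min_(X < [set: G] | connected_dominating X) #|X|]|.

Lemma connected_dominating_setT (G : sgraph) :
  connected_graph G -> connected_dominating [set: G].
Proof.
case/andP=> G0 /forallP Gc; apply/andP; split.
  by apply/forallP=> v; rewrite inE.
apply/andP; split; first by rewrite card_sig cardsT.
apply/forallP=> x; apply/forallP=> y; move/forallP: (Gc (val x)) => /(_ (val y)).
case/connectP=> p; elim: p x => [|z p IHp] x /=.
  by move=> _ /val_inj ->; apply: connect0.
case/andP=> xz pz yE; pose z' : induced [set: G] := Sub z (in_setT z).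
exact: (connect_trans (connect1 (xz : edge x z')) (IHp z' pz yE)).
Qed.

Lemma gamma_cP (G : sgraph) : connected_graph G ->
  (exists2 X : {set G}, connected_dominating X & #|X| = gamma_c G) /\
  (forall X : {set G}, connected_dominating X -> gamma_c G <= #|X|).
Proof.
move=> /connected_dominating_setT cdT; rewrite /gamma_c.
by case: arg_minnP => // X cdX minX; split => //; exists X.
Qed.

(* Main.v *)
(** Pick every vertex independently with probability [p]; let [S] be the random
    set and [U] the set of vertices whose closed neighbourhood misses [S]. Then
    [S :|: U] dominates, and it becomes connected at the cost of two vertices
    per component, so [gamma_c G <= #|S| + 3 #|U| + 2 c(S)] with [c(S)] the
    number of components of [G[S]]. Giving each vertex [v] of [S] the weight
    [1 / #|N[v] :&: S|] shows that [E c(S) <= n / (k + 1)], whatever [p] is.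
    Taking [p = (ln (k + 1) + ln m) / (k + 1)] with [m] the ceiling of
    [ln (k + 1)] makes [E #|U| <= n / ((k + 1) m)], and [3 / m + 2 <= 4] when
    [2 <= m]; the case [k <= 3] is trivial, since the bound is then at least [n]. *)

Require Import Defs.
From HB Require Import structures.
From mathcomp Require Import all_boot all_order all_fingroup all_algebra.
From mathcomp Require Import all_reals all_analysis.
From mathcomp Require Import lra zify.

Import Order.TTheory GRing.Theory Num.Theory.

Local Open Scope ring_scope.

(** * Connectivity inside a vertex set, and joining its components *)

Definition edge_in {G : sgraph} (S : {set G}) : rel G :=
  fun x y => [&& x \in S, y \in S & edge x y].

Lemma edge_in_sym {G : sgraph} (S : {set G}) : connect_sym (edge_in S).
Proof.
by apply: sym_connect_sym => x y; rewrite /edge_in andbCA edge_sym.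
Qed.

Lemma connect_edge_inS {G : sgraph} (S T : {set G}) (x y : G) :
  S \subset T -> connect (edge_in S) x y -> connect (edge_in T) x y.
Proof.
move=> /subsetP sST; apply: connect_sub => u v /and3P[uS vS uv].
by apply: connect1; rewrite /edge_in !sST.
Qed.

Lemma connect_edge_in_mem {G : sgraph} (S : {set G}) (x y : G) :
  x \in S -> connect (edge_in S) x y -> y \in S.
Proof.
move=> xS /connectP[p]; elim: p x xS => [|z p IH] x xS /=; first by move=> _ ->.
by case/andP=> /and3P[_ zS _]; apply: IH.
Qed.

Lemma connected_induced {G : sgraph} (X : {set G}) (x0 : G) :
  x0 \in X -> {in X &, forall x y, connect (edge_in X) x y} ->
  connected_graph (Defs.induced X).
Proof.
move=> x0X Xc; apply/andP; split; first by rewrite card_sig; apply/card_gt0P; exists x0.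
apply/forallP=> x; apply/forallP=> y.
have /connectP[p] := Xc _ _ (valP x) (valP y).
elim: p x => [|z p IHp] x /=; first by move=> _ /val_inj ->; apply: connect0.
case/andP=> /and3P[_ zX xz] pz yE; pose z' : Defs.induced X := Sub z zX.
exact: (connect_trans (connect1 (xz : edge x z')) (IHp z' pz yE)).
Qed.

(* Two [G[D]]-components at distance at most 3 exist as long as [G[D]] is
   disconnected; joining them costs two vertices and one representative. *)
Lemma connected_dominating_extension {G : sgraph} (D F : {set G}) :
  connected_graph G -> dominating D -> F \subset D -> D != set0 ->
  {in D, forall x, exists2 f, f \in F & connect (edge_in D) x f} ->
  exists2 X : {set G}, connected_dominating X & (#|X| <= #|D| + 2 * #|F|)%N.
Proof.
move=> Gc; move nF: #|F| => n; elim: n D F nF => [|n IH] D F nF domD sFD D0 DF.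
  by have [x /DF[f]] := set0Pn _ D0; rewrite (cards0_eq nF) inE.
have [x0 x0D] := set0Pn _ D0.
have [/forall_inP Dc|/forall_inPn[x xD /forall_inPn[y yD xy]]] :=
    boolP [forall x in D, forall y in D, connect (edge_in D) x y].
  exists D; last exact: leq_addr.
  rewrite /connected_dominating domD; apply: (connected_induced _ x0) => // x y xD yD.
  by have /forall_inP := Dc x xD; apply.
(* [A] is the component of [x] in [G[D]], and [NA] its closed neighbourhood in [G]. *)
pose A := [set z | connect (edge_in D) x z].
pose NA := [set z | (z \in A) || [exists a in A, edge a z]].
have AD : A \subset D by apply/subsetP=> z; rewrite inE; apply: connect_edge_in_mem.
have step a z : a \in A -> z \in D -> edge a z -> z \in A.
  move=> aA zD az; move: (aA); rewrite !inE => /connect_trans; apply.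
  by apply: connect1; rewrite /edge_in zD az (subsetP AD).
have yNA : y \notin NA.
  rewrite inE negb_or; apply/andP; split; first by rewrite inE.
  by apply/exists_inPn=> a aA; apply: contra xy => /(step _ _ aA yD); rewrite inE.
have xNA : x \in NA by rewrite !inE connect0.
(* A path of [G] from [x] to [y] has to leave [NA]; [u] and [w] are the ends of an edge where it
   does. *)
have [u [w [uNA wNA uw]]] : exists u w, [/\ u \in NA, w \notin NA & edge u w].
  have /andP[_ /forallP/(_ x)/forallP/(_ y)/connectP[p xp yE]] := Gc.
  move: xp yNA; rewrite {}yE; elim: p (x) xNA => [|z p IHp] u uNA /=; first by rewrite uNA.
  case/andP=> uz zp lastNA; have [zNA|zNA] := boolP (z \in NA); last by exists u, z.
  exact: IHp zNA zp lastNA.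
have [uA wNa] : u \notin A /\ forall a, a \in A -> ~~ edge a w.
  have wNa a : a \in A -> ~~ edge a w.
    by move=> aA; apply: contra wNA => aw; rewrite inE; apply/orP; right; apply/exists_inP; exists a.
  by split=> //; apply: contraL uw; apply: wNa.
have [a aA au] : exists2 a, a \in A & edge a u.
  by move: uNA; rewrite inE (negPf uA) => /exists_inP[a]; exists a.
(* Either [w] is in [D], or some vertex of [D] dominates it; no neighbour of [w] lies in [A], so [b]
   is in another component and [a], [u], [w], [b] link the two. *)
have [b bD [bA wb]] : exists2 b, b \in D & b \notin A /\ ((w == b) || edge w b).
  have [wD|wD] := boolP (w \in D).
    by exists w => //; rewrite eqxx; split=> //; apply: contra wNA => wA; rewrite inE wA.
  have /forallP/(_ w)/implyP/(_ wD)/existsP[b /andP[bD wb]] := domD.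
  exists b => //; rewrite wb orbT; split=> //.
  by apply/negP => /wNa; rewrite edge_sym wb.
pose D' := D :|: [set u; w].
have sDD' : D \subset D' by apply: subsetUl.
have uD' : u \in D' by rewrite !inE eqxx orbT.
have wD' : w \in D' by rewrite !inE eqxx !orbT.
have aD' : a \in D' by rewrite (subsetP sDD') ?(subsetP AD).
have bD' : b \in D' by rewrite (subsetP sDD').
have ua : connect (edge_in D') u a by apply: connect1; rewrite /edge_in uD' aD' edge_sym.
have wu : connect (edge_in D') w u by apply: connect1; rewrite /edge_in uD' wD' edge_sym.
have bw : connect (edge_in D') b w.
  rewrite edge_in_sym; case/orP: wb => [/eqP->|wb]; first exact: connect0.
  by apply: connect1; rewrite /edge_in bD' wD'.
have ba : connect (edge_in D') b a := connect_trans bw (connect_trans wu ua).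
have [fa faF afa] := DF a (subsetP AD _ aA).
have [fb fbF bfb] := DF b bD.
have fab : fa != fb.
  apply: contra bA => /eqP fab; move: aA; rewrite !inE => /connect_trans; apply.
  by apply: (connect_trans afa); rewrite fab edge_in_sym.
have aF : exists2 f, f \in F :\ fb & connect (edge_in D') a f.
  by exists fa; [rewrite !inE fab | apply: connect_edge_inS afa].
have [|||||X cdX cX] := IH D' (F :\ fb).
- by apply/eqP; rewrite -eqSS -nF (cardsD1 fb F) fbF.
- apply/forallP=> v; apply/implyP=> vD'.
  have vD : v \notin D by apply: contra vD'; apply: (subsetP sDD').
  have /forallP/(_ v)/implyP/(_ vD)/existsP[c /andP[cD vc]] := domD.
  by apply/existsP; exists c; rewrite (subsetP sDD').
- exact: subset_trans (subset_trans (subsetDl _ _) sFD) sDD'.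
- by apply/set0Pn; exists u.
- have [f fF af] := aF.
  move=> z; rewrite /D' in_setU in_set2 => /orP[zD|/orP[]/eqP->].
  + have [g gF zg] := DF z zD; have {}zg := connect_edge_inS _ _ _ _ sDD' zg.
    have [gfb|gfb] := eqVneq g fb; last by exists g; rewrite // !inE gfb.
    exists f => //; apply: connect_trans af; apply: connect_trans ba.
    apply: (connect_trans zg); rewrite gfb edge_in_sym.
    exact: connect_edge_inS bfb.
  + by exists f => //; apply: connect_trans af.
  + by exists f => //; apply: connect_trans af; apply: connect_trans ua.
exists X => //; apply: leq_trans cX _; rewrite mulnS addnA leq_add2r.
apply: leq_trans (leq_card_setU _ _) _.
by rewrite leq_add2l cards2; case: (u == w).
Qed.

(** * Closed neighbourhoods and the bound for a fixed set *)

Definition closed_nbhd {G : sgraph} (v : G) : {set G} := v |: [set w | edge v w].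

Definition undominated {G : sgraph} (S : {set G}) : {set G} :=
  [set v | closed_nbhd v :&: S == set0].

Lemma closed_nbhd_id {G : sgraph} (v : G) : v \in closed_nbhd v.
Proof. by rewrite setU11. Qed.

Lemma card_closed_nbhd {G : sgraph} (v : G) : #|closed_nbhd v| = (degree v).+1.
Proof. by rewrite cardsU1 inE edge_irrefl. Qed.

Lemma min_degree_le {G : sgraph} (v : G) : (min_degree G <= degree v)%N.
Proof.
rewrite /min_degree; have := mem_index_enum v.
elim: (index_enum _) => // w s IH; rewrite inE big_cons => /orP[/eqP<-|/IH].
  exact: geq_minl.
exact/leq_trans/geq_minr.
Qed.

(* Each component [C] of [G[S]] contributes at least [1]: the closed
   neighbourhood of a vertex of [C] meets [S] inside [C], so each of the [#|C|]
   terms is at least [1 / #|C|]. *)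
Lemma component_representatives (R : realType) {G : sgraph} (S : {set G}) :
  exists F : {set G}, [/\ F \subset S,
    {in S, forall x, exists2 f, f \in F & connect (edge_in S) x f} &
    #|F|%:R <= \sum_(v in S) (#|closed_nbhd v :&: S|%:R)^-1 :> R].
Proof.
pose r := fingraph.root (edge_in S); exists (r @: S); split.
- apply/subsetP=> _ /imsetP[x xS ->].
  exact: connect_edge_in_mem xS (connect_root _ _).
- by move=> x xS; exists (r x); [apply: imset_f | apply: connect_root].
rewrite (partition_big r (mem (r @: S))); last by move=> v; apply: imset_f.
rewrite -sum1_card natr_sum; apply: ler_sum => _ /imsetP[x xS ->].
pose C := [set v in S | r v == r x].
have CE v : (v \in S) && (r v == r x) = (v \in C) by rewrite inE.
have C0 : (0 < #|C|)%N by apply/card_gt0P; exists x; rewrite inE xS eqxx.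
rewrite (eq_bigl _ _ CE); apply: (@le_trans _ _ (\sum_(v in C) (#|C|%:R)^-1)).
  by rewrite sumr_const -[leRHS]mulr_natl divff // pnatr_eq0 -lt0n.
apply: ler_sum => v; rewrite inE => /andP[vS /eqP rv].
rewrite lef_pV2 ?posrE ?ltr0n //; last first.
  by apply/card_gt0P; exists v; rewrite inE vS closed_nbhd_id.
rewrite ler_nat; apply/subset_leq_card/subsetP=> w.
move=> /setIP[/setU1P[->|vw] wS]; first by rewrite inE vS rv eqxx.
move: vw; rewrite !inE wS -rv /= => vw; rewrite root_connect; last exact: edge_in_sym.
by apply: connect1; rewrite /edge_in wS vS edge_sym.
Qed.

(** Extend [S :|: U] with the representatives [F :|: U], each undominated vertex representing
    itself: it is paid once for membership and twice for joining, hence the factor 3. *)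
Lemma gamma_c_le_set (R : realType) {G : sgraph} (S : {set G}) :
  connected_graph G ->
  (gamma_c G)%:R <= #|S|%:R + 3 * #|undominated S|%:R
    + 2 * \sum_(v in S) (#|closed_nbhd v :&: S|%:R)^-1 :> R.
Proof.
move=> Gc; have [F [sFS SF cF]] := component_representatives R S.
set U := undominated S; pose D := S :|: U.
have domD : dominating D.
  apply/forallP=> v; apply/implyP; rewrite !inE negb_or => /andP[vS].
  case/set0Pn=> w; rewrite !inE => /andP[/predU1P[->|vw] wS]; first by rewrite wS in vS.
  by apply/existsP; exists w; rewrite vw !inE wS.
have sFD : F :|: U \subset D by apply: setSU.
have [x _] : exists x : G, true.
  by have /andP[/card_gt0P[x _] _] := Gc; exists x.
have D0 : D != set0.
  apply/set0Pn; have [xD|xD] := boolP (x \in D); first by exists x.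
  have /forallP/(_ x)/implyP/(_ xD)/existsP[w /andP[wD _]] := domD.
  by exists w.
have DF : {in D, forall x, exists2 f, f \in F :|: U & connect (edge_in D) x f}.
  move=> y; rewrite in_setU => /orP[/SF[f fF yf]|yU]; last first.
    by exists y; [rewrite in_setU yU orbT | apply: connect0].
  exists f; first by rewrite in_setU fF.
  by apply: connect_edge_inS yf; apply: subsetUl.
have [X cdX cX] := connected_dominating_extension _ _ Gc domD sFD D0 DF.
have [_ /(_ X cdX) gX] := gamma_cP Gc.
have cU : (#|D| <= #|S| + #|U|)%N by apply: leq_card_setU.
have cFU : (#|F :|: U| <= #|F| + #|U|)%N by apply: leq_card_setU.
have {cX cU cFU gX} : (gamma_c G <= #|S| + 3 * #|U| + 2 * #|F|)%N by lia.
rewrite -(ler_nat R) => /le_trans; apply.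
by rewrite 2!natrD 2!natrM lerD2l ler_pM2l.
Qed.

(** * Random vertex sets *)

(** The probability that the random set is exactly [S]; expectations are finite sums against this
    weight. *)
Definition bernoulli_weight {R : realType} {T : finType} (p : R) (S : {set T}) : R :=
  \prod_v (if v \in S then p else 1 - p).

Lemma bernoulli_weight_ge0 (R : realType) (T : finType) (p : R) (S : {set T}) :
  0 <= p <= 1 -> 0 <= bernoulli_weight p S.
Proof. by case/andP=> p0 p1; apply: prodr_ge0 => v _; case: ifP; rewrite ?subr_ge0. Qed.

Lemma bernoulli_weight_sum (R : realType) (T : finType) (p : R) :
  \sum_(S : {set T}) bernoulli_weight p S = 1.
Proof.
by rewrite -bigA_distr big1 // => v _ /=; rewrite addrC subrK.
Qed.

Lemma bernoulli_weight_mem (R : realType) (T : finType) (p : R) (v : T) :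
  \sum_(S : {set T} | v \in S) bernoulli_weight p S = p.
Proof.
(* With the factor for omitting [v] set to 0, expanding the product of sums keeps only the sets that
   contain [v]. *)
pose q u := if u == v then 0 else 1 - p.
transitivity (\prod_u (p + q u)); last first.
  rewrite (bigD1 v) //= /q eqxx addr0 big1 ?mulr1 // => u /negPf->.
  by rewrite addrC subrK.
rewrite bigA_distr big_mkcond; apply: eq_bigr => S _; case: ifP => vS.
  by apply: eq_bigr => u _; rewrite /q; case: eqP => // ->; rewrite vS.
by rewrite (bigD1 v) //= vS /q eqxx mul0r.
Qed.

Lemma bernoulli_weight_disjoint (R : realType) (T : finType) (p : R) (A : {set T}) :
  \sum_(S : {set T} | A :&: S == set0) bernoulli_weight p S = (1 - p) ^+ #|A|.
Proof.
(* Dually, the factor for choosing a vertex of [A] is set to 0, which kills the sets meeting [A]. *)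
pose q u := if u \in A then 0 else p.
transitivity (\prod_u (q u + (1 - p))); last first.
  rewrite (bigID (mem A)) /= [X in _ * X]big1 ?mulr1; last first.
    by move=> u /negPf uA; rewrite /q uA addrC subrK.
  rewrite -prodr_const; apply: eq_bigr => u uA.
  by rewrite /q uA add0r.
rewrite bigA_distr big_mkcond; apply: eq_bigr => S _; case: ifP => [AS|/negbT/set0Pn[u]].
  apply: eq_bigr => u _; rewrite /q; case: ifP => // uS; case: ifP => // uA.
  by have := in_set0 u; rewrite -(eqP AS) inE uA uS.
by rewrite inE => /andP[uA uS]; rewrite (bigD1 u) //= uS /q uA mul0r.
Qed.

Lemma bernoulli_weight_imset (R : realType) (T : finType) (p : R) (f : T -> T)
  (S : {set T}) : injective f -> bernoulli_weight p (f @: S) = bernoulli_weight p S.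
Proof.
move=> fI; rewrite /bernoulli_weight (reindex_inj fI).
by apply: eq_bigr => v _; rewrite mem_imset.
Qed.

(* The sum is the same for all [v \in A], by transposing elements of [A], and
   the total over [v \in A] is the probability that the set meets [A]. *)
Lemma bernoulli_weight_inv_card (R : realType) (T : finType) (p : R) (A : {set T})
  (v : T) : 0 <= p <= 1 -> v \in A ->
  \sum_(S : {set T} | v \in S) bernoulli_weight p S / #|A :&: S|%:R <= (#|A|%:R)^-1.
Proof.
move=> p01 vA; pose E u := \sum_(S : {set T} | u \in S) bernoulli_weight p S / #|A :&: S|%:R.
have A0 : 0 < #|A|%:R :> R by rewrite ltr0n; apply/card_gt0P; exists v.
have EE u : u \in A -> E u = E v.
  move=> uA; have tI := @perm_inj _ (tperm u v).
  rewrite /E (reindex_inj (imset_inj tI)) /=; apply: eq_big => [S|S _].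
    by rewrite -{1}(tpermR u v) mem_imset.
  have tA : tperm u v @: A = A.
    apply/eqP; rewrite eqEcard card_imset // leqnn andbT; apply/subsetP=> _ /imsetP[w wA ->].
    by case: tpermP => // ->.
  rewrite bernoulli_weight_imset // -{1}tA -imsetI; last by move=> ? ? _ _; apply: tI.
  by rewrite card_imset.
rewrite -[leLHS]/(E v) -[leRHS]mul1r ler_pdivlMr // mulr_natr -sumr_const.
rewrite -(eq_bigr _ EE) (exchange_big_dep xpredT) //= -[leRHS](bernoulli_weight_sum R T p).
apply: ler_sum => S _.
under eq_bigl => u do rewrite -in_setI.
(* The equal shares of [S] add up to its weight, or to 0 when [S] misses [A]. *)
rewrite sumr_const -[leLHS]mulr_natr; have [->|S0] := eqVneq #|A :&: S| 0%N.
  by rewrite mulr0 bernoulli_weight_ge0.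
by rewrite divfK // pnatr_eq0.
Qed.

(** * Averaging, and the choice of [p] *)

(** Average [gamma_c_le_set] over all [S] and exchange sums: a vertex is chosen with probability
    [p], is undominated with probability [(1 - p) ^+ #|N[v]|], and has expected weight at most [1 /
    #|N[v]|], where [#|N[v]|] is at least [k.+1]. *)
Lemma gamma_c_le_probability (R : realType) {G : sgraph} (k : nat) (p : R) :
  connected_graph G -> (k <= min_degree G)%N -> 0 <= p <= 1 ->
  (gamma_c G)%:R <= #|G|%:R * (p + 3 * (1 - p) ^+ k.+1 + 2 / k.+1%:R) :> R.
Proof.
move=> Gc kG p01; have /andP[p0 p1] := p01.
pose w := @bernoulli_weight R G p.
have kN v : (k.+1 <= #|@closed_nbhd G v|)%N.
  by rewrite card_closed_nbhd ltnS (leq_trans kG) // min_degree_le.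
have -> : (gamma_c G)%:R = \sum_(S : {set G}) w S * (gamma_c G)%:R.
  by rewrite -mulr_suml bernoulli_weight_sum mul1r.
apply: le_trans (ler_sum _ (fun S _ => ler_wpM2l (bernoulli_weight_ge0 _ _ _ S p01)
  (gamma_c_le_set R S Gc))) _.
under eq_bigr do rewrite !mulrDr mulrCA [X in _ + X]mulrCA.
rewrite !big_split -!mulr_sumr /= !mulrDr; apply: lerD; first apply: lerD.
- under eq_bigr do rewrite -sum1_card natr_sum mulr_sumr.
  rewrite (exchange_big_dep xpredT) //=.
  under eq_bigr do under eq_bigr do rewrite mulr1.
  under eq_bigr do rewrite bernoulli_weight_mem.
  by rewrite sumr_const mulr_natl.
- rewrite mulrCA ler_pM2l //.
  under eq_bigr do rewrite -sum1_card natr_sum mulr_sumr.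
  rewrite (exchange_big_dep xpredT) //=.
  under eq_bigr do under eq_bigl do rewrite inE.
  under eq_bigr do under eq_bigr do rewrite mulr1.
  under eq_bigr do rewrite bernoulli_weight_disjoint.
  rewrite mulr_natl -sumr_const; apply: ler_sum => v _.
  by apply: ler_wiXn2l; rewrite ?subr_ge0 ?gerBl.
- rewrite mulrCA ler_pM2l //.
  under eq_bigr do rewrite mulr_sumr.
  rewrite (exchange_big_dep xpredT) //= mulr_natl -sumr_const.
  apply: ler_sum => v _.
  apply: le_trans (bernoulli_weight_inv_card _ _ _ _ _ p01 (closed_nbhd_id v)) _.
  by rewrite lef_pV2 ?posrE ?ltr0n ?ler_nat // (leq_trans _ (kN v)).
Qed.

Theorem theorem7p2 (R : realType) (G : sgraph) (k : nat) :
  connected_graph G ->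
  (k <= min_degree G)%N ->
  (gamma_c G)%:R <=
    #|G|%:R * (ln (k%:R + 1) + ln (Num.ceil (ln (k%:R + 1 : R)))%:~R + 4)
      / (k%:R + 1) :> R.
Proof.
move=> Gc kG; rewrite natr1; set x : R := k.+1%:R; set m := Num.ceil (ln x).
have x1 : 1 <= x by rewrite ler1n.
have x0 : 0 < x by apply: lt_le_trans x1.
have gn : (gamma_c G)%:R <= #|G|%:R :> R.
  have [_ /(_ _ (connected_dominating_setT Gc))] := gamma_cP Gc.
  by rewrite cardsT ler_nat.
have lnx0 : 0 <= ln x by apply: ln_ge0.
have trivial_bound : x <= ln x + ln m%:~R + 4 ->
    (gamma_c G)%:R <= #|G|%:R * (ln x + ln m%:~R + 4) / x.
  move=> h; apply: le_trans gn _; rewrite -mulrA ler_peMr //.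
  by rewrite ler_pdivlMr // mul1r.
have m0 : 0 <= m by rewrite /m ceil_ge0 (lt_le_trans _ lnx0) // ltrN10.
have lnm0 : 0 <= ln (m%:~R : R).
  (* For [k = 0] the ceiling is 0, and [ln 0] is 0 by convention. *)
  have [->|m1] := eqVneq m 0; first by rewrite ln0.
  by apply: ln_ge0; rewrite ler1z -gtz0_ge1 lt_def m1.
have [x4|x4] := lerP x 4; first by apply: trivial_bound; rewrite (le_trans x4) // lerDr addr_ge0.
have m2 : 2 <= (m%:~R : R).
  have e4 : expR 1 <= 4 :> R.
    (* From [expR (- 2^-1) >= 2^-1] one gets [expR 2^-1 <= 2]; squaring gives the bound. *)
    have e1 : expR 1 = expR 2^-1 * expR 2^-1 :> R by rewrite -expRD; congr expR; lra.
    have := expR_ge1Dx (- 2^-1 : R); have := expRxMexpNx_1 (2^-1 : R).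
    by rewrite e1; have := expR_gt0 (2^-1 : R); nra.
  have : 1 < ln x by rewrite -(expRK 1) ltr_ln ?posrE ?expR_gt0 // (le_lt_trans e4).
  rewrite -[2]/(2%:~R) ler_int; have := ceil_ge (ln x).
  rewrite -/m => h1 h2; have := lt_le_trans h2 h1.
  by rewrite ltr1z.
pose L := ln x + ln m%:~R : R.
(* The choice [p = L / x] is a probability only if [L <= x]; otherwise the bound exceeds [#|G|]. *)
have [xL|Lx] := lerP x L; first by apply: trivial_bound; rewrite -/L; lra.
have p01 : 0 <= L / x <= 1.
  apply/andP; split; first by rewrite divr_ge0 ?addr_ge0 // ltW.
  by rewrite ler_pdivrMr // mul1r ltW.
apply: le_trans (gamma_c_le_probability R _ _ Gc kG p01) _.
rewrite -mulrA ler_wpM2l // -/x -/L.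
(* By [1 - t <= expR (- t)], the power is at most [expR (- L)], which is [1 / (x m)] by the choice
   of [L]. *)
have pk : (1 - L / x) ^+ k.+1 <= (x * m%:~R)^-1.
  have -> : (x * m%:~R)^-1 = expR (- (L / x)) ^+ k.+1.
    rewrite -expRM_natl -/x mulrN [x * (L / x)]mulrC divfK ?gt_eqF // expRN expRD !lnK // posrE //.
    by apply: lt_le_trans m2.
  apply: lerXn2r; rewrite ?nnegrE ?expR_ge0 ?subr_ge0 ?(andP p01).2 //.
  exact: expR_ge1Dx.
have mi : (m%:~R : R)^-1 <= 2^-1 by rewrite lef_pV2 ?posrE // (lt_le_trans _ m2).
have xm : x^-1 * (m%:~R)^-1 <= x^-1 * 2^-1 by rewrite ler_wpM2l // invr_ge0 ltW.
rewrite invfM in pk; rewrite [leRHS]mulrDl.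
have y0 : 0 < x^-1 by rewrite invr_gt0.
(* With the nonlinear terms abstracted, what remains is [3 / 2 + 2 <= 4], scaled by [x^-1]. *)
move: xm pk y0; move: ((1 - L / x) ^+ k.+1) (x^-1) (L / x) (x^-1 / m%:~R) => e y z t; lra.
Qed.
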